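(* Let $X$ be a set, let $Y$ be a nonempty subset of $X$, and let $\mathbb{S}(Y)$ be a subsemigroup of $T(Y)$. Then $T_{\mathbb{S}(Y)}(X)$ is a regular semigroup if and only if one of the following holds: (i) $\mathbb{S}(Y)$ is a subgroup of $\mathrm{Sym}(Y)$; (ii) $\mathbb{S}(Y)$ is regular and $Y = X$.
   Context: Semigroups (hence subsemigroups) are nonempty. For a set $A$, $T(A)$ is the semigroup of all maps $A\to A$ under composition (composed from left to right, with $xf$ denoting the image of $x$ under $f$), and $\mathrm{Sym}(A)$ is the group of all bijections $A\to A$. For $f\in T(X)$ with $Yf\subseteq Y$, $f_{\upharpoonright_Y}\in T(Y)$ denotes the map $Y\to Y$ that agrees with $f$ on $Y$. Define $T_{\mathbb{S}(Y)}(X)=\{f\in T(X) : Yf\subseteq Y \text{ and } f_{\upharpoonright_Y}\in\mathbb{S}(Y)\}$, a subsemigroup of $T(X)$. A semigroup $S$ is regular if for every $a\in S$ there is $b\in S$ with $aba=a$. *)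

(* Defs.v *)
From HB Require Import structures.
From mathcomp Require Import all_boot.
From mathcomp Require Import boolp classical_sets.

Set Implicit Arguments.
Unset Strict Implicit.
Unset Printing Implicit Defensive.

Local Open Scope classical_set_scope.
Local Open Scope group_scope.

(* T(A).  The alias carries the monoid structure in which maps are composed
   from left to right: x (f * g) = (x f) g. *)
Definition transf (A : Type) : Type := A -> A.

Section TransfMonoid.
Variable A : Type.

HB.instance Definition _ := gen_eqMixin (transf A).
HB.instance Definition _ := gen_choiceMixin (transf A).

Definition transf_mul (f g : transf A) : transf A := fun x => g (f x).
Definition transf_one : transf A := fun x => x.

Lemma transf_mulA : associative transf_mul. Proof. by []. Qed.
Lemma transf_mul1 : left_id transf_one transf_mul. Proof. by []. Qed.
Lemma transf_mulr1 : right_id transf_one transf_mul. Proof. by []. Qed.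

HB.instance Definition _ :=
  isMonoid.Build (transf A) transf_mulA transf_mul1 transf_mulr1.

End TransfMonoid.

Definition Sym (A : Type) : set (transf A) := [set f | bijective f].
Arguments Sym : clear implicits.

Definition subsemigroup (M : semigroupType) (S : set M) : Prop :=
  S !=set0 /\ {in S &, forall a b, a * b \in S}.

Definition regular_semigroup (M : semigroupType) (S : set M) : Prop :=
  subsemigroup S /\ {in S, forall a, exists2 b, b \in S & a * b * a = a}.

(* H is a subgroup of G, where G is a group under the operation of the ambient
   monoid M, with the unit of M as its identity. *)
Definition subgroup (M : monoidType) (G H : set M) : Prop :=
  [/\ H `<=` G,
      1 \in H,
      {in H &, forall a b, a * b \in H} &
      {in H, forall a, exists2 b, b \in H & a * b = 1 /\ b * a = 1}].

Section Restriction.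
Variables (X : Type) (Y : set X).

Definition restr (f : transf X) (fY : f @` Y `<=` Y) : transf Y :=
  fun y => SigSub (mem_set (fY _ (imageP f (set_valP y)))).

Definition T_restr (S : set (transf Y)) : set (transf X) :=
  [set f | exists fY : f @` Y `<=` Y, restr fY \in S].

Lemma T_restr_subsemigroup (S : set (transf Y)) :
  subsemigroup S -> subsemigroup (T_restr S).
Proof.
move=> [[s Ss] SM]; split.
  pose f : transf X := fun x =>
    if pselect (x \in Y) is left xY then val (s (SigSub xY)) else x.
  have fE (y : Y) : f (val y) = val (s y).
    rewrite /f; case: pselect => [yY|]; last by case; exact: valP.
    by congr (val (s _)); apply: val_inj.
  have fY : f @` Y `<=` Y.
    move=> _ [y Yy <-].
    by rewrite -[y]/(val (SigSub (mem_set Yy))) fE; exact: set_valP.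
  exists f, fY; suff -> : restr fY = s by rewrite inE.
  by apply/funext => y; apply: val_inj; rewrite /= fE.
move=> f g; rewrite !inE => -[fY fS] [gY gS].
have fgY : (f * g : transf X) @` Y `<=` Y.
  move=> _ [y Yy <-].
  exact: (gY _ (imageP g (fY _ (imageP f Yy)))).
exists fgY; suff -> : restr fgY = restr fY * restr gY by exact: SM.
by apply/funext => y; apply: val_inj.
Qed.

End Restriction.

(* Main.v *)
(* If [Y <> X], a map in [T_restr S] may send the points outside [Y] to any
   chosen [y] in [Y].  Regularity then puts [y] in the image of the restriction
   of that map to [Y], so every element of [S] is surjective; in a regular
   semigroup of surjections the inner inverses are two-sided inverses.
   Conversely, an inner inverse of [f] is an inner inverse of its restriction
   on [Y] and a choice of preimages off [Y]. *)
Require Import Defs.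
From mathcomp Require Import all_boot.
From mathcomp Require Import boolp classical_sets.

Local Open Scope classical_set_scope.

Section Extension.
Set Implicit Arguments.
Unset Strict Implicit.
Variables (X : Type) (Y : set X).
Implicit Types (h : X -> X) (s : transf Y) (S : set (transf Y)).

(** The case split must return the proof of [x \in Y], since [s] acts on the subtype. The values [h]
    off [Y] stay free: each use picks its own. *)
Definition extend h s : transf X := fun x =>
  if pselect (x \in Y) is left xY then val (s (SigSub xY)) else h x.

Lemma extend_val h s (y : Y) : extend h s (val y) = val (s y).
Proof.
rewrite /extend; case: pselect => [yY|]; last by case; exact: valP.
by congr (val (s _)); apply: val_inj.
Qed.

Lemma extend_out h s x : ~ Y x -> extend h s x = h x.
Proof. by rewrite /extend; case: pselect => // xY; have := set_mem xY. Qed.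

Lemma extend_T_restr h s S : s \in S -> extend h s \in T_restr S.
Proof.
move=> sS.
have hY : extend h s @` Y `<=` Y.
  move=> _ [y Yy <-].
  by rewrite -[y]/(val (SigSub (mem_set Yy))) extend_val; exact: set_valP.
rewrite inE; exists hY; suff -> : restr hY = s by [].
by apply/funext => y; apply: val_inj; rewrite /= extend_val.
Qed.

Lemma T_restrP S (f : transf X) : f \in T_restr S ->
  exists2 s, s \in S & forall y : Y, f (val y) = val (s y).
Proof. by rewrite inE => -[fY fS]; exists (restr fY). Qed.

(** Asking for [a (b y) = y] only at points [y] in the range of [f] lets one statement serve both
    the group case and the case [Y = setT]. *)
Lemma inner_inverse_T_restr S (f : transf X) (a b : transf Y) :
    (forall y : Y, f (val y) = val (a y)) -> b \in S ->
    (forall (x : X) (y : Y), f x = val y -> a (b y) = y) ->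
  exists2 g, g \in T_restr S & (f * g * f)%g = f.
Proof.
move=> fa bS abK.
have [h hK] : exists h : X -> X, forall x, f (h (f x)) = f x.
  suff /choice[h hK] : forall z, exists x, range f z -> f x = z.
    by exists h => x; apply: hK; exists x.
  move=> z; have [[x _ fx]|Nz] := pselect (range f z); first by exists x.
  (* Off the range of [f] the value is arbitrary; [z] is at hand. *)
  by exists z.
exists (extend h b); first exact: extend_T_restr.
apply/funext => x; change (f (extend h b (f x)) = f x).
have [Yfx|NYfx] := pselect (Y (f x)); last by rewrite extend_out.
pose y : Y := SigSub (mem_set Yfx).
by rewrite -[f x]/(val y) extend_val fa (abK x).
Qed.

Lemma regular_T_restr_regular S :
  subsemigroup S -> regular_semigroup (T_restr S) -> regular_semigroup S.
Proof.
move=> SS [_ regT]; split=> // s sS.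
have [g /T_restrP[t tS gt] fgf] := regT _ (extend_T_restr id sS).
exists t => //; apply/funext => y; apply: val_inj.
have /= := congr1 (@^~ (val y)) fgf.
change (extend id s (g (extend id s (val y))) = extend id s (val y) ->
  val (s (t (s y))) = val (s y)).
by rewrite !(extend_val, gt).
Qed.

Lemma regular_T_restr_surj S s :
    Y <> setT -> regular_semigroup (T_restr S) -> s \in S ->
  forall y, exists z, s z = y.
Proof.
move=> NYT [_ regT] sS y.
have [x NYx] : exists x, ~ Y x.
  apply: contrapT => Nex; apply: NYT; apply/seteqP; split=> // x _.
  by apply: contrapT => NYx; apply: Nex; exists x.
have [g /T_restrP[t tS gt] fgf] := regT _ (extend_T_restr (fun=> val y) sS).
exists (t y); apply: val_inj.
(* At [x], outside [Y], the map has value [y], so [fgf] reads [s (t y) = y]. *)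
have := congr1 (@^~ x) fgf.
pose f := extend (fun=> val y) s.
change (f (g (f x)) = f x -> val (s (t y)) = val y).
by rewrite {}/f (@extend_out _ _ x)// gt extend_val.
Qed.

End Extension.

(** Surjectivity of [s] cancels it on one side of [s * t * s = s]; surjectivity of [t], also in [S],
    gives the other inverse law. *)
Lemma regular_surj_subgroup (A : Type) (S : set (transf A)) :
    regular_semigroup S -> {in S, forall s, forall y, exists x, s x = y} ->
  subgroup (Sym A) S.
Proof.
move=> [[[s0 /mem_set s0S] SM] regS] surjS.
have invS : {in S, forall s, exists2 t, t \in S & s * t = 1 /\ t * s = 1}%g.
  move=> s sS; have [t tS sts] := regS s sS.
  have tsK y : s (t y) = y.
    by have [x <-] := surjS s sS y; exact: (congr1 (@^~ x) sts).
  have stK y : t (s y) = y by have [x <-] := surjS t tS y; rewrite tsK.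
  by exists t => //; split; apply/funext.
split=> //.
  move=> s /mem_set /invS[t _ [st ts]].
  by exists t => x; [exact: (congr1 (@^~ x) st)|exact: (congr1 (@^~ x) ts)].
(* The unit lies in [S] as the product of [s0] and its inverse. *)
by have [t tS [<- _]] := invS _ s0S; exact: SM.
Qed.

Theorem theorem3p3 (X : Type) (Y : set X) (S : set (transf Y)) :
  Y !=set0 ->
  subsemigroup S ->
  (regular_semigroup (T_restr S) <->
   subgroup (Sym Y) S \/ (regular_semigroup S /\ Y = setT)).
Proof.
move=> _ SS; split=> [regT|HS].
  have regS := regular_T_restr_regular SS regT.
  have [YT|NYT] := pselect (Y = setT); [by right|left].
  by apply: regular_surj_subgroup => // s sS; exact: regular_T_restr_surj regT sS.
split=> [|f /T_restrP[a aS fa]]; first exact: T_restr_subsemigroup.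
case: HS => [[_ _ _ invS]|[[_ regS] YT]].
  have [b bS [_ ba]] := invS a aS.
  apply: (inner_inverse_T_restr fa bS) => x y _.
  exact: (congr1 (@^~ y) ba).
have [b bS aba] := regS a aS.
apply: (inner_inverse_T_restr fa bS) => x y fxy.
(* As [Y] is everything, [x] lies in [Y], so [y] is a value of [a], where [aba] applies. *)
have Yx : x \in Y by rewrite YT inE.
have <- : a (SigSub Yx) = y by apply: val_inj; rewrite -fa.
exact: (congr1 (@^~ (SigSub Yx)) aba).
Qed.
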